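(* Let $X$ be a non-separable Banach space. Then there exists an exceedingly rich family $\mathcal{S}$ of closed linear subspaces of $X$ such that for every $Y\in\mathcal{S}$ all three of the following equivalences hold: (1) $X$ is a Gurariĭ space if and only if $Y$ is a Gurariĭ space; (2) $X$ is an $L_1$-predual space if and only if $Y$ is an $L_1$-predual space; (3) $X$ has the Daugavet property if and only if $Y$ has the Daugavet property.
   Context: Banach spaces are over $\mathbb{R}$. For a topological space $Z$, $\operatorname{dens}Z$ is the least cardinality of a dense subset, and $\omega$ is the first infinite cardinal. A nonempty family $\mathcal{A}$ of sets is up-directed if for all $A,B\in\mathcal{A}$ there is $C\in\mathcal{A}$ with $A\cup B\subset C$. A family $\mathcal{S}$ of closed subsets of a topological space $X$ is exceedingly rich if: (R-a) for every $Y\subset X$ there is $S\in\mathcal{S}$ with $Y\subset S$ and $\max\{\operatorname{dens}Y,\omega\}=\operatorname{dens}S$; (R-b) if $\mathcal{A}\subset\mathcal{S}$ is up-directed, then $\overline{\bigcup\mathcal{A}}\in\mathcal{S}$. A Banach space $X$ is a Gurariĭ space if for every $\varepsilon>0$, all finite-dimensional normed spaces $E\subset F$ and every linear isometric embedding $T:E\to X$, there is a linear extension $\hat T:F\to X$ of $T$ with $(1+\varepsilon)^{-1}\|x\|\le\|\hat Tx\|\le(1+\varepsilon)\|x\|$ for every $x\in F$. A Banach space $X$ is an $L_1$-predual space if for every $\varepsilon>0$, all finite-dimensional normed spaces $E\subset F$ and every linear isometric embedding $T:E\to X$, there is a linear extension $\hat T:F\to X$ of $T$ with $\|\hat Tx\|\le(1+\varepsilon)\|x\|$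 for every $x\in F$. A Banach space $X$ has the Daugavet property if $\|\mathrm{Id}_X-T\|=1+\|T\|$ for every bounded rank-one operator $T:X\to X$. *)

(* Defs.v *)
From HB Require Import structures.
From mathcomp Require Import all_boot all_order all_algebra.
From mathcomp Require Import all_classical all_reals all_analysis.

Set Implicit Arguments.
Unset Strict Implicit.
Unset Printing Implicit Defensive.

Import Order.TTheory GRing.Theory Num.Theory.
Import numFieldNormedType.Exports.

Local Open Scope classical_set_scope.
Local Open Scope card_scope.
Local Open Scope ring_scope.

Section MinCard.
Variables (T : Type) (P : set (set T)).

Lemma min_card_ex : P !=set0 -> exists2 A, P A & forall B, P B -> A #<= B.
Proof.
move=> P0.
(* A maximal family of choice functions on P that pairwise differ at every
   member of P. *)
pose ok (F : set (set T -> T)) :=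
  (forall f, F f -> forall A, P A -> A (f A)) /\
  (forall f g A, F f -> F g -> P A -> f A = g A -> f = g).
have [|F [okF Fmax]] := @Zorn_bigcup _ ok.
  move=> C Cok Ctot; split.
    by move=> f [F CF Ff]; exact: (Cok F CF).1.
  move=> f g A [F CF Ff] [G CG Gg].
  by have [FG|GF] := Ctot F G CF CG;
    [apply: (Cok G CG).2 => //; exact: FG|apply: (Cok F CF).2 => //; exact: GF].
have [[A PA Asurj]|noA] := pselect (exists2 A, P A &
    forall a, A a -> exists2 f, F f & f A = a).
  exists A => // B PB.
  have /choice[s sP] : forall a, exists f, A a -> F f /\ f A = a.
    move=> a; have [Aa|nAa] := pselect (A a); last by exists (fun=> a).
    by have [f Ff fa] := Asurj a Aa; exists f.
  have : {in A &, injective (fun a => s a B)}.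
    move=> a b /set_mem Aa /set_mem Ab /= sab.
    have [Fa <-] := sP _ Aa; have [Fb <-] := sP _ Ab.
    by rewrite (okF.2 _ _ B Fa Fb PB sab).
  move=> /inj_card_eq cA; rewrite -(card_le_eql cA).
  by apply: subset_card_le => _ [a Aa <-]; exact: okF.1 (sP _ Aa).1 _ PB.
exfalso.
have /choice[h hP] : forall A, exists a, P A -> A a /\ forall f, F f -> f A <> a.
  move=> A; have [PA|nPA] := pselect (P A); last first.
    have [B PB] := P0; apply: contrapT => noT; apply: noA; exists B => // a.
    by exfalso; apply: noT; exists a.
  apply: contrapT => noa; apply: noA; exists A => // a Aa.
  apply: contrapT => nof; apply: noa; exists a => _; split => // f Ff fa.
  by apply: nof; exists f.
have [A PA] := P0.
have nFh : ~ F h by move=> Fh; exact: (hP A PA).2 _ Fh erefl.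
apply: (Fmax (F `|` [set h])).
  by split; [exact: subsetUl|move=> /(_ h (or_intror erefl))].
split.
  by move=> f [Ff|->] B PB; [exact: okF.1 Ff _ PB|exact: (hP B PB).1].
move=> f g B [Ff|->] [Fg|->] PB e //.
- exact: okF.2 Ff Fg PB e.
- by have := (hP B PB).2 _ Ff e.
- by have := (hP B PB).2 _ Fg (esym e).
Qed.

End MinCard.

Section Density.
Variable T : topologicalType.
Implicit Types Z D : set T.

Definition dense_in Z D := D `<=` Z /\ Z `<=` closure D.

(* Cardinals are represented by sets, compared with #<= and #=: [dens Z] is a
   dense subset of Z of least cardinality (see densP). *)
Definition dens Z : set T :=
  xget set0 [set D | dense_in Z D /\ forall D', dense_in Z D' -> D #<= D'].

Lemma densP Z :
  dense_in Z (dens Z) /\ forall D, dense_in Z D -> dens Z #<= D.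
Proof.
rewrite /dens; case: xgetP => [D _ //|no].
have [|D DZ Dmin] := @min_card_ex _ (dense_in Z).
  by exists Z; split => //; exact: subset_closure.
by have := no D (conj DZ Dmin).
Qed.

Definition separable := exists2 D : set T, countable D & dense D.

End Density.

Definition card_is_max (T U V : Type) (A : set T) (B : set U) (C : set V) :=
  (A #<= B /\ C #= B) \/ (B #<= A /\ C #= A).

Definition up_directed (T : Type) (F : set (set T)) :=
  F !=set0 /\
  forall A B, F A -> F B -> exists2 C, F C & A `|` B `<=` C.

Definition exceedingly_rich (T : topologicalType) (S : set (set T)) :=
  [/\ forall A, S A -> closed A,
      forall Y : set T, exists2 A, S A &
        Y `<=` A /\ card_is_max (dens Y) [set: nat] (dens A)
    & forall F, F `<=` S -> up_directed F -> S (closure (\bigcup_(A in F) A))].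

(* A linear subspace E of V, as a normed space with the norm of V. *)
Section Submod.
Variables (R : realType) (V : normedModType R) (E : submodClosed V).

Definition submod := {x : V | x \in E}.

HB.instance Definition _ := [isSub of submod for @sval V (fun x => x \in E)].
HB.instance Definition _ := [Choice of submod by <:].
HB.instance Definition _ := [SubChoice_isSubLmodule of submod by <:].

Definition submod_norm (x : submod) : R := `|val x|.

Lemma submod_normD x y : submod_norm (x + y) <= submod_norm x + submod_norm y.
Proof. by rewrite /submod_norm raddfD ler_normD. Qed.

Lemma submod_normZ (l : R) x : submod_norm (l *: x) = `|l| * submod_norm x.
Proof. by rewrite /submod_norm linearZ normrZ. Qed.

Lemma submod_norm0_eq0 x : submod_norm x = 0 -> x = 0.
Proof. by move=> /normr0_eq0 x0; apply: val_inj; rewrite x0 raddf0. Qed.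

HB.instance Definition _ := Lmodule_isNormed.Build R submod
  submod_normD submod_normZ submod_norm0_eq0.

Lemma submod_normE (x : submod) : `|x| = `|val x|.
Proof. by []. Qed.

End Submod.

(* Completeness plays no role in the definitions below; they apply to a Banach
   space and to its closed linear subspaces alike. *)
Section BanachProperties.
Variables (R : realType) (X : normedModType R).

Definition finite_dimensional (F : normedModType R) :=
  exists n (e : 'I_n -> F), forall x, exists c : 'I_n -> R,
    x = \sum_i c i *: e i.

Definition gurarii :=
  forall eps : R, 0 < eps ->
  forall F : normedModType R, finite_dimensional F ->
  forall (E : submodClosed F) (T : {linear submod E -> X}),
    (forall x, `|T x| = `|x|) ->
  exists That : {linear F -> X},
    (forall x : submod E, That (val x) = T x) /\
    (forall x, (1 + eps)^-1 * `|x| <= `|That x| <= (1 + eps) * `|x|).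

Definition L1_predual :=
  forall eps : R, 0 < eps ->
  forall F : normedModType R, finite_dimensional F ->
  forall (E : submodClosed F) (T : {linear submod E -> X}),
    (forall x, `|T x| = `|x|) ->
  exists That : {linear F -> X},
    (forall x : submod E, That (val x) = T x) /\
    (forall x, `|That x| <= (1 + eps) * `|x|).

Definition bounded_operator (T : X -> X) :=
  exists M : R, forall x, `|T x| <= M * `|x|.

Definition rank_one (T : X -> X) :=
  exists2 v : X, v != 0 & range T = range (fun c : R => c *: v).

(* Only meaningful for bounded operators: [sup] is 0 on unbounded sets. *)
Definition opnorm (T : X -> X) : R :=
  sup [set `|T x| | x in [set x : X | `|x| <= 1]].

Definition daugavet :=
  forall T : {linear X -> X}, bounded_operator T -> rank_one T ->
    opnorm (fun x => x - T x) = 1 + opnorm T.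

End BanachProperties.

(* Main.v *)
(** The family consists of the closed subspaces [Y] that are almost isometric
    ideals of [X] (finite-dimensional subspaces of [X] are mapped almost
    isometrically into [Y], fixing what already lies in [Y]) and contain a fixed
    countable set [W]. Such subspaces are abundant by a Löwenheim-Skolem
    argument, and the class is stable under closures of directed unions.

    Each of the three properties passes from [X] to an almost isometric ideal
    [Y]. For the two extension properties, one extends into [X] and pushes the
    extension into [Y] by an almost isometry. For the Daugavet property, a
    functional [g] on [Y] extends to [X] as an ultralimit of [g \o Q] over almost
    isometries [Q] into [Y]; this keeps every bound
    [`|y - g y *: v| <= K * `|y|], so that an operator on [Y] violating the
    Daugavet equation extends to one on [X]. Conversely, a failure of one of the
    properties in [X] is witnessed by countably many vectors, which are put
    into [W]. *)
Require Import Defs.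
From HB Require Import structures.
From mathcomp Require Import all_boot all_order all_algebra.
From mathcomp Require Import all_classical all_reals all_analysis.
From mathcomp Require Import lra.
Import Order.TTheory GRing.Theory Num.Theory.
Import numFieldNormedType.Exports.
Local Open Scope classical_set_scope.
Local Open Scope card_scope.
Local Open Scope ring_scope.

Set Implicit Arguments.
Unset Strict Implicit.
Unset Printing Implicit Defensive.

(** * Cardinal arithmetic of infinite sets *)

Lemma card_leE (T U : Type) (u0 : U) (A : set T) (B : set U) :
  A #<= B <-> exists2 f : T -> U, set_fun A B f & set_inj A f.
Proof.
split=> [/card_leP[f]|[f fAB fI]].
  exists (fun x => if pselect (A x) is left Ax then
    val (f (SigSub (mem_set Ax))) else u0).
    by move=> x Ax; case: pselect => // Ax'; exact: set_mem (valP (f _)).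
  move=> x y /set_mem Ax /set_mem Ay; case: pselect => // Ax'.
  case: pselect => // Ay' /val_inj /(@inj _ _ _ f).
  by rewrite !inE => /(_ Logic.I Logic.I) [].
have [g] : $|{injfun A >-> B}| by apply/injfunPex; exists f.
exact: inj_card_le g.
Qed.

Lemma card_le_rel (T U : Type) (A : set T) (B : set U) (G : T -> U -> Prop) :
  (forall x, A x -> exists2 y, B y & G x y) ->
  (forall x x' y, A x -> A x' -> G x y -> G x' y -> x = x') -> A #<= B.
Proof.
move=> AB GI; have [[u0]|noU] := pselect (inhabited U); last first.
  suff -> : A = set0 by exact: card_ge0.
  by rewrite -subset0 => x /AB[y _ _]; apply: noU; exists.
have /choice[f fP] : forall x, exists y, A x -> B y /\ G x y.
  move=> x; have [Ax|nAx] := pselect (A x); last by exists u0.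
  by have [y By Gxy] := AB x Ax; exists y.
apply/(card_leE u0); exists f; first by move=> x /fP[].
move=> x y /set_mem Ax /set_mem Ay fxy.
by apply: (GI _ _ (f x)) => //; [exact: (fP x Ax).2|rewrite fxy; exact: (fP y Ay).2].
Qed.

(** Comparability is the existence of a least cardinal applied to the family consisting of [A] and
    [B]. *)
Lemma card_le_total (T : Type) (A B : set T) : A #<= B \/ B #<= A.
Proof.
have [|C [->|->] Cmin] := @min_card_ex _ [set A; B]; first by exists A; left.
  by left; apply: Cmin; right.
by right; apply: Cmin; left.
Qed.

(* Zorn's lemma is applied to the graphs of partial surjections from a set
   [B] onto [B `*` B]: a maximal one has [B] as large as [T], as otherwise a
   copy of [B] in its complement could be used to extend it. *)
Lemma infinite_pairing (T : Type) :
  infinite_set [set: T] -> exists J : T * T -> T, injective J.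
Proof.
move=> Tinf; have [u0 _] := infinite_setN0 Tinf.
have /(card_leE u0)[i _ iI] := (infiniteP _).1 Tinf.
have {}iI : injective i by move=> m n; apply: iI; rewrite inE.
pose gr : Type := (T * T * T)%type.
pose G0 : set gr := range (fun mn : nat * nat => (i mn.1, i mn.2, i (pickle mn))).
pose dm (G : set gr) : set T := [set a | exists c, G (a, a, c)].
(* [G (a, b, c)] means that [c] is a code of the pair [(a, b)]. A pair may have several codes, but a
   code determines its pair. *)
pose good (G : set gr) := [/\ G0 `<=` G,
  forall a b c, G (a, b, c) -> [/\ dm G a, dm G b & dm G c],
  forall a b, dm G a -> dm G b -> exists c, G (a, b, c) &
  forall p q c, G (p, c) -> G (q, c) -> p = q].
have G0dm n : dm G0 (i n) by exists (i (pickle (n, n))); exists (n, n).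
have goodG0 : good G0.
  split => //.
  - by move=> a b c [[m n] _] [<- <- <-]; split; exact: G0dm.
  - move=> a b [c [[m m'] _] [<- _ _]] [d [[n n'] _] [<- _ _]].
    by exists (i (pickle (m, n))); exists (m, n).
  - move=> p q c [mn _] [<- <-] [mn' _] [<-] /iI e.
    by rewrite (pcan_inj pickleK e).
have dmS G H : G `<=` H -> dm G `<=` dm H by move=> GH a [c] /GH; exists c.
have [|G [Gok Gmax]] := @Zorn_bigcup gr [set G | G = set0 \/ good G].
  move=> F Fok Ftot.
  have [[H0 [FH0 gH0]]|noH] := pselect (exists H, F H /\ good H); last first.
    left; rewrite -subset0 => x [H FH Hx].
    by have [H0|gH] := Fok H FH; [rewrite H0 in Hx|apply: noH; exists H].
  have Fgood H x : F H -> H x -> good H.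
    by move=> /Fok[->|].
  have SF H : F H -> H `<=` \bigcup_(K in F) K by move=> FH x; exists H.
  have join H K x y : F H -> F K -> H x -> K y ->
      exists L, [/\ F L, good L, H `<=` L & K `<=` L].
    move=> FH FK Hx Ky; have [HK|KH] := Ftot H K FH FK.
      by exists K; split => //; exact: Fgood Ky.
    by exists H; split => //; exact: Fgood Hx.
  right; split.
  - by apply: subset_trans (SF _ FH0); case: gH0.
  - move=> a b c [H FH Habc]; have [_ /(_ _ _ _ Habc)[? ? ?] _ _] := Fgood _ _ FH Habc.
    by split; apply: (dmS _ _ (SF _ FH)).
  - move=> a b [c [H FH Hc]] [d [K FK Kd]].
    have [L [FL [_ _ gL _] HL KL]] := join _ _ _ _ FH FK Hc Kd.
    have La : dm L a by exists c; exact: HL.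
    have Lb : dm L b by exists d; exact: KL.
    have [e Le] := gL a b La Lb.
    by exists e; exists L.
  - move=> p q c [H FH Hc] [K FK Kd].
    have [L [FL [_ _ _ gL] HL KL]] := join _ _ _ _ FH FK Hc Kd.
    by apply: gL; [exact: HL Hc|exact: KL Kd].
have {}Gok : good G.
  case: Gok => // G_0; exfalso; apply: (Gmax G0); last by right.
  rewrite G_0; split; first exact: sub0set.
  by move=> /(_ (i 0%N, i 0%N, i (pickle (0%N, 0%N)))); apply; exists (0%N, 0%N).
have [G0G Gdm Gtot Ginj] := Gok.
set B := dm G.
have Binf : infinite_set B.
  apply/infiniteP/(card_leE u0); exists i; last by move=> m n _ _ /iI.
  by move=> n _; exact: dmS G0G _ _.
have B2 : B `*` B #<= B.
  apply: (@card_le_rel _ _ _ _ (fun p c => G (p, c))).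
    move=> [a b] [/= Ba Bb]; have [c Gc] := Gtot a b Ba Bb.
    by exists c => //; case: (Gdm _ _ _ Gc).
  by move=> p q c _ _; exact: Ginj.
(* Two distinct tags [b0] and [b1] embed the union of [B] and [C] into the square of [B]. *)
have BU (C : set T) : C #<= B -> B `|` C #<= B.
  move=> /(card_leE u0)[f fCB fI]; apply: card_le_trans B2.
  have [b0 Bb0] := infinite_setN0 Binf.
  have [b1 [Bb1 b10]] : exists b1, B b1 /\ b1 <> b0.
    apply: contrapT => no; apply: Binf; apply: (@sub_finite_set _ _ [set b0]) => // b Bb.
    by apply: contrapT => ?; apply: no; exists b.
  apply/(card_leE (u0, u0)).
  exists (fun x => if pselect (B x) is left _ then (b0, x) else (b1, f x)).
    by move=> x [Bx|Cx] /=; case: pselect => //= nBx; split => //=; exact: fCB.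
  move=> x y /set_mem BCx /set_mem BCy /=; case: pselect => Bx; case: pselect => By.
  - by case.
  - by case=> /esym.
  - by case.
  - case: BCx => // Cx; case: BCy => // Cy [] /fI; rewrite !inE; exact.
have BnB : [set: T] #<= B.
  have [CB|BC] := card_le_total (~` B) B; first by rewrite -(setUv B); exact: BU.
  exfalso; have /(card_leE u0)[h hBC hI] := BC.
  pose C := h @` B; have CB : C #<= B by exact: card_image_le.
  have BC' : B #<= C by apply/(card_leE u0); exists h => // x Bx; exists x.
  have nBC x : C x -> ~ B x by move=> [y By <-]; exact: hBC.
  have : (B `|` C) `*` (B `|` C) #<= C.
    apply: card_le_trans BC'; apply: card_le_trans B2.
    have /(card_leE u0)[k kB kI] := BU _ CB.
    apply/(card_leE (u0, u0)); exists (fun p => (k p.1, k p.2)).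
      by move=> [a b] [/= Ba Bb]; split; exact: kB.
    move=> [a b] [c d] /set_mem[/= Ba Bb] /set_mem[/= Bc Bd] [].
    by move=> /kI -> ; rewrite ?inE// => /kI -> ; rewrite ?inE.
  move=> /(card_leE u0)[k kC kI].
  (* The new pairs get their codes in [C], which is disjoint from [B], so no old code is reused. *)
  pose H : set gr := [set pc | [/\ (B `|` C) pc.1.1, (B `|` C) pc.1.2,
    ~ (B pc.1.1 /\ B pc.1.2) & pc.2 = k pc.1]].
  have dmH : dm (G `|` H) = B `|` C.
    apply/seteqP; split => x.
      by move=> [c [Gx|[]//]]; left; exists c.
    move=> [[c Gx]|Cx]; first by exists c; left.
    by exists (k (x, x)); right; split; [right|right|move=> [/(nBC _ Cx)]|].
  apply: (Gmax (G `|` H)).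
    split; first exact: subsetUl.
    have [b0 Bb0] := infinite_setN0 Binf.
    have Cb : C (h b0) by exists b0.
    move=> /(_ (h b0, h b0, k (h b0, h b0))) sub.
    have /Gdm[/(nBC _ Cb)//] : G (h b0, h b0, k (h b0, h b0)).
    by apply: sub; right; split; [right|right|move=> [/(nBC _ Cb)]|].
  right; split; rewrite ?dmH.
  - exact: subset_trans G0G (@subsetUl _ _ _).
  - move=> a b c [/Gdm[Ba Bb Bc]|[/= BCa BCb _ ->]]; first by split; left.
    by split => //; right; apply: kC; split.
  - move=> a b BCa BCb; have [[Ba Bb]|nB] := pselect (B a /\ B b).
      by have [c Gc] := Gtot a b Ba Bb; exists c; left.
    by exists (k (a, b)); right; split.
  - move=> [a b] [a' b'] c [Gc|[/= Ha Hb _ ce]] [Gc'|[/= Ha' Hb' _ ce']].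
    + exact: Ginj Gc Gc'.
    + exfalso; have [_ _] := Gdm _ _ _ Gc; apply: nBC; rewrite ce'.
      by apply: kC.
    + exfalso; have [_ _] := Gdm _ _ _ Gc'; apply: nBC; rewrite ce.
      by apply: kC.
    + by apply: kI; rewrite ?inE//= -ce -ce'.
have /(card_leE u0)[e eB eI] := BnB.
have /(card_leE u0)[J JB JI] := B2.
exists (fun p => J (e p.1, e p.2)) => -[a b] [c d] /JI.
have Be x : e x \in B by rewrite inE; exact: eB.
rewrite !inE => /(_ (conj (set_mem (Be _)) (set_mem (Be _)))).
move=> /(_ (conj (set_mem (Be _)) (set_mem (Be _)))) [].
by move=> /eI -> ; rewrite ?inE// => /eI -> ; rewrite ?inE.
Qed.

(** Folding the pairing over a list separates lists of equal length; pairing the result with the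
    length separates all lists. *)
Lemma infinite_seq_coding (T : Type) :
  infinite_set [set: T] -> exists J : seq (nat + T) -> T, injective J.
Proof.
move=> Tinf; have [J JI] := infinite_pairing Tinf.
have [u0 _] := infinite_setN0 Tinf.
have /(card_leE u0)[i _ iI] := (infiniteP _).1 Tinf.
have {}iI : injective i by move=> m n; apply: iI; rewrite inE.
pose e (x : nat + T) := match x with
  inl n => J (i 0%N, i n) | inr t => J (i 1%N, t) end.
have eI : injective e by move=> [m|s] [n|t] /= /JI [] // => [/iI ->|/iI//|/iI//|->].
pose g := foldr (fun x y => J (e x, y)) u0.
have gI s t : size s = size t -> g s = g t -> s = t.
  elim: s t => [|x s IH] [|y t] //= [st] /JI[/eI -> gst].
  by rewrite (IH t).
exists (fun s => J (i (size s), g s)) => s t /JI[/iI st].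
exact: gI.
Qed.

(** The closure consists of the values of finite terms over [A]. Terms are trees, and a tree is
    encoded by a finite word over [nat + A], so there are at most as many terms as elements of
    [A]. *)
Lemma finitary_closure (T : choiceType) (A : set T) (op : nat -> seq T -> T) :
  infinite_set A ->
  exists D : set T, [/\ A `<=` D,
    forall n s, (forall x, x \in s -> D x) -> D (op n s) & D #<= A].
Proof.
move=> Ainf.
have A'inf : infinite_set [set: A].
  by rewrite infiniteP (card_le_eqr (card_setT A)) -infiniteP.
have [J JI] := infinite_seq_coding A'inf.
pose eval := fix eval (t : GenTree.tree A) : T := match t with
  | GenTree.Leaf a => val a
  | GenTree.Node n s => op n (map eval s) end.
exists (range eval); split.
- by move=> x Ax; exists (GenTree.Leaf (SigSub (mem_set Ax))).
- move=> n s sD; suff [ts <-] : exists ts, map eval ts = s.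
    by exists (GenTree.Node n ts).
  elim: s sD => [|x s IH] sD; first by exists [::].
  have [t _ tx] := sD x (mem_head _ _).
  have [|ts tss] := IH; first by move=> y ys; apply: sD; rewrite inE ys orbT.
  by exists (t :: ts); rewrite /= tx tss.
- apply: card_le_trans (card_image_le _ _) _.
  rewrite -(card_le_eqr (card_setT A)).
  have [a0 _] := infinite_setN0 A'inf.
  apply/(card_leE a0); exists (J \o (@GenTree.encode A)) => // s t _ _ /JI.
  exact: (pcan_inj (@GenTree.codeK A)).
Qed.

(** Each point of [B] is the value of a constant operation, so a closure of [A] under countably many
    operations contains [B]. *)
Lemma infinite_setU_card (T : choiceType) (A B : set T) :
  infinite_set A -> countable B -> A `|` B #<= A.
Proof.
move=> Ainf cB; have [a0 _] := infinite_setN0 Ainf.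
have /(card_leE 0%N)[f _ fI] := cB.
pose op (n : nat) (s : seq T) : T := xget a0 (B `&` f @^-1` [set n]).
have [D [AD Dop DA]] := finitary_closure op Ainf.
apply: card_le_trans DA; apply: subset_card_le => x [/AD//|Bx].
suff -> : x = op (f x) [::] by apply: Dop.
rewrite /op; case: xgetP => [y _ [By /= fy]|/(_ x)[]//].
by apply: fI; rewrite ?inE.
Qed.

Lemma countable_setU (T : Type) (A B : set T) :
  countable A -> countable B -> countable (A `|` B).
Proof.
move=> cA cB.
have -> : A `|` B = \bigcup_(b in [set: bool]) if b then A else B.
  apply/seteqP; split => x; first by case=> ?; [exists true|exists false].
  by move=> [[] _ ?]; [left|right].
by apply: bigcup_countable => // -[].
Qed.

(** * Finite linear combinations *)

Section Lincomb.
Variables (R : realType) (X : lmodType R) (k : nat).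
Implicit Types (c d : 'I_k -> R) (x y : 'I_k -> X).

Definition lincomb c x : X := \sum_i c i *: x i.

Lemma lincombDl c d x : lincomb (fun i => c i + d i) x = lincomb c x + lincomb d x.
Proof. by rewrite -big_split; apply: eq_bigr => i _; rewrite scalerDl. Qed.

Lemma lincombBl c d x : lincomb (fun i => c i - d i) x = lincomb c x - lincomb d x.
Proof. by rewrite -sumrB; apply: eq_bigr => i _; rewrite scalerBl. Qed.

Lemma lincombBr c x y : lincomb c (fun i => x i - y i) = lincomb c x - lincomb c y.
Proof. by rewrite -sumrB; apply: eq_bigr => i _; rewrite scalerBr. Qed.

Lemma lincombZl a c x : lincomb (fun i => a * c i) x = a *: lincomb c x.
Proof. by rewrite scaler_sumr; apply: eq_bigr => i _; rewrite scalerA. Qed.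

Lemma lincomb_delta x i : lincomb (fun j => (j == i)%:R) x = x i.
Proof.
rewrite /lincomb (bigD1 i)//= eqxx scale1r big1 ?addr0// => j /negPf ->.
by rewrite scale0r.
Qed.

End Lincomb.

Lemma linear_lincomb (R : realType) (X Y : lmodType R) (T : {linear X -> Y}) k
    (c : 'I_k -> R) (x : 'I_k -> X) : T (lincomb c x) = lincomb c (T \o x).
Proof. by rewrite linear_sum; apply: eq_bigr => i _; rewrite linearZ. Qed.

(** * Almost isometric ideals: existence and stability *)

Section AlmostIdeal.
Variables (R : realType) (X : normedModType R).

Lemma norm_lincomb k (c : 'I_k -> R) (x : 'I_k -> X) :
  `|lincomb c x| <= \sum_i `|c i| * `|x i|.
Proof.
by apply: le_trans (ler_norm_sum _ _ _) _; apply: ler_sum => i _; rewrite normrZ.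
Qed.

(** By homogeneity the coefficients may be scaled to l1-norm [N]. Rounding them to integers changes
    the norms by at most the sums of the [|x i|] and of the [|x' i|]; scaling back divides these
    errors by [N]. *)
Lemma lincomb_grid k N (x x' : 'I_k -> X) : (0 < N)%N ->
  (forall f : {ffun 'I_k -> 'I_N.*2.+1},
     `| `|lincomb (fun i => (f i)%:R - N%:R) x'| -
        `|lincomb (fun i => (f i)%:R - N%:R) x| | <= 1) ->
  forall c, `| `|lincomb c x'| - `|lincomb c x| | <=
    (2 * \sum_i `|x i| + k%:R + 1) / N%:R * \sum_i `|c i|.
Proof.
move=> N0 fP c; set s := \sum_i `|c i|.
have NR0 : 0 < N%:R :> R by rewrite ltr0n.
(* The coordinate vectors belong to the grid, so each [x' i] is bounded in terms of [x i]. *)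
have xx' i : `|x' i| <= `|x i| + 1.
  pose f : {ffun 'I_k -> 'I_N.*2.+1} := [ffun j => inord (N + (j == i))].
  have fE (z : 'I_k -> X) : lincomb (fun j => (f j)%:R - N%:R) z = z i.
    rewrite -[RHS]lincomb_delta; apply: eq_bigr => j _; congr (_ *: _).
    rewrite ffunE inordK; first by rewrite natrD addrAC subrr add0r.
    by rewrite ltnS -addnn leq_add2l (leq_trans (leq_b1 _)).
  by have := fP f; rewrite !fE ler_norml => /andP[_]; lra.
have [s0|s_neq0] := eqVneq s 0.
  have c0 i : c i = 0.
    apply/eqP; rewrite -normr_eq0; apply/eqP.
    by have /psumr_eq0P := s0; apply.
  by rewrite s0 mulr0 /lincomb !big1 ?subrr ?normr0// => i _; rewrite c0 scale0r.
have s_gt0 : 0 < s by rewrite lt_neqAle eq_sym s_neq0 sumr_ge0.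
pose t i := N%:R * (c i / s).
have tN i : - N%:R <= t i <= N%:R.
  rewrite -ler_norml /t !normrM (gtr0_norm NR0) normfV (gtr0_norm s_gt0).
  rewrite ler_piMr ?ler0n// ler_pdivrMr// mul1r /s (bigD1 i)//= lerDl.
  exact: sumr_ge0.
(* The shift by [N] moves [t j] into the interval from 0 to [2N], where truncation lands in the
   index type. *)
pose f : {ffun 'I_k -> 'I_N.*2.+1} := [ffun j => inord (Num.truncn (t j + N%:R))].
have ft i : `|t i - ((f i)%:R - N%:R)| <= 1.
  have ti : 0 <= t i + N%:R by have := tN i; lra.
  have := truncn_itv ti; rewrite ffunE inordK; last first.
    rewrite -(ltr_nat R) -addnn -addn1 !natrD.
    by have := tN i; have /andP[] := truncn_itv ti; lra.
  rewrite -[_.+1]addn1 natrD => /andP[h1 h2]; rewrite ler_norml; apply/andP; split; lra.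
have ftz (z : 'I_k -> X) :
    `| `|lincomb t z| - `|lincomb (fun i => (f i)%:R - N%:R) z| | <= \sum_i `|z i|.
  apply: le_trans (ler_dist_dist _ _) _; rewrite -lincombBl.
  apply: le_trans (norm_lincomb _ _) _; apply: ler_sum => i _.
  by rewrite ler_piMl.
have tE (z : 'I_k -> X) : `|lincomb c z| = s / N%:R * `|lincomb t z|.
  rewrite /t !lincombZl (_ : lincomb (fun i => c i / s) z = s^-1 *: lincomb c z).
    rewrite !normrZ normfV (gtr0_norm s_gt0) (gtr0_norm NR0) mulrA divfK ?gt_eqF//.
    by rewrite mulVKf.
  by rewrite -lincombZl; apply: eq_bigr => i _; rewrite mulrC.
rewrite !tE -mulrBr normrM (gtr0_norm (divr_gt0 s_gt0 NR0)).
rewrite [leRHS]mulrAC -[leRHS]mulrA [leRHS]mulrC ler_wpM2l ?(ltW (divr_gt0 s_gt0 NR0))//.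
have sx' : \sum_i `|x' i| <= \sum_i `|x i| + k%:R.
  rewrite -[k in k%:R]card_ord -sum1_card natr_sum -big_split/=.
  exact: ler_sum.
have := ftz x; have := ftz x'; have := fP f.
rewrite !ler_norml => /andP[? ?] /andP[? ?] /andP[? ?]; apply/andP; split; lra.
Qed.

(* For [x] spanning a finite-dimensional subspace, [x i |-> x' i] is an
   almost isometric map into [D] that fixes prescribed points of [D]. *)
Definition almost_ideal (D : set X) :=
  forall k (b : pred 'I_k) (x : 'I_k -> X) (eps : R), 0 < eps ->
    (forall i, b i -> D (x i)) ->
  exists x' : 'I_k -> X, [/\ forall i, D (x' i), forall i, b i -> x' i = x i &
    forall c, `| `|lincomb c x'| - `|lincomb c x| | <= eps * \sum_i `|c i|].

(* Countably many operations suffice: up to any prescribed error, a finite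
   family is determined by the integer parts of the norms of its linear
   combinations with coefficients in a finite grid. *)
Lemma almost_ideal_closure (A : set X) : infinite_set A ->
  exists D, [/\ A `<=` D, almost_ideal D & D #<= A].
Proof.
move=> Ainf.
pose code k N (x : 'I_k -> X) : seq nat :=
  [seq Num.truncn `|lincomb (fun i => (f i)%:R - N%:R) x|
     | f : {ffun 'I_k -> 'I_N.*2.+1} <- enum {ffun 'I_k -> 'I_N.*2.+1}].
pose opT : countType := {k : nat & (nat * 'I_k * {ffun 'I_k -> bool} * seq nat)%type}.
pose rep k N (b : {ffun 'I_k -> bool}) (v : seq nat) (s : seq X) : 'I_k -> X :=
  xget (fun=> 0) [set x | (forall i, b i -> x i = s`_i) /\ code k N x = v].
(* The index [n] encodes all discrete data, including the coordinate [j] to return; the vectors to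
   be fixed are passed in [s]. *)
pose op (n : nat) (s : seq X) : X :=
  if unpickle n is Some (existT k (N, j, b, v)) then rep k N b v s j else 0.
have [D [AD Dop DA]] := @finitary_closure X A op Ainf.
exists D; split => // k b x eps eps0 bx.
have [d0 /AD Dd0] := infinite_setN0 Ainf.
set M := 2 * \sum_i `|x i| + k%:R + 1.
pose N := (Num.truncn (M / eps)).+1.
have MN : M / N%:R <= eps.
  rewrite ler_pdivrMr ?ltr0n// mulrC -ler_pdivrMr//; apply: ltW.
  exact: truncnS_gt.
pose fb : {ffun 'I_k -> bool} := [ffun i => b i].
(* The positions that are not prescribed are filled with [d0], so that all arguments lie in [D]. *)
pose s := [seq if b i then x i else d0 | i <- enum 'I_k].
have sE (i : 'I_k) : b i -> s`_i = x i.
  by move=> bi; rewrite (nth_map i) ?size_enum_ord// nth_ord_enum bi.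
have sD y : y \in s -> D y.
  by move=> /mapP[i _ ->]; case: ifP => // /bx.
pose x' := rep k N fb (code k N x) s.
have [x'b x'c] : (forall i, fb i -> x' i = s`_i) /\ code k N x' = code k N x.
  rewrite /x' /rep; case: xgetP => [y _ //|/(_ x)]; case; split => // i.
  by rewrite ffunE => /sE.
exists x'; split.
- move=> i; have := Dop (pickle (existT _ k (N, i, fb, code k N x) : opT)) _ sD.
  by rewrite /op pickleK.
- by move=> i bi; rewrite x'b ?ffunE// sE.
- move=> c; apply: le_trans (lincomb_grid _ (x := x) (N := N) _ c) _ => //; last first.
    by rewrite ler_wpM2r// sumr_ge0.
  move=> f; have /eq_in_map/(_ f) := x'c; rewrite mem_enum => /(_ isT).
  have := truncn_itv (normr_ge0 (lincomb (fun i => (f i)%:R - N%:R) x')).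
  have := truncn_itv (normr_ge0 (lincomb (fun i => (f i)%:R - N%:R) x)).
  move=> hx hx' e; move: hx hx'; rewrite e -!natr1 => /andP[? ?] /andP[? ?].
  by rewrite ler_norml; apply/andP; split; lra.
Qed.

(** Only finitely many points are prescribed, and directedness puts them into one member of [F]. *)
Lemma almost_ideal_bigcup (F : set (set X)) : up_directed F ->
  (forall A, F A -> almost_ideal A) -> almost_ideal (\bigcup_(A in F) A).
Proof.
move=> [[A0 FA0] Fdir] Fai k b x eps eps0 bx.
suff [A FA Ax] : exists2 A, F A & forall i, b i -> A (x i).
  have [x' [x'A x'b x'c]] := Fai A FA k b x eps eps0 Ax.
  by exists x'; split => // i; exists A.
have [A FA Ax] : exists2 A, F A & forall i, i \in enum 'I_k -> b i -> A (x i).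
  elim: (enum 'I_k) => [|i s [A FA As]]; first by exists A0.
  have [bi|nbi] := boolP (b i); last first.
    by exists A => // j; rewrite inE => /predU1P[->|/As//]; rewrite (negPf nbi).
  have [B FB Bi] := bx i bi; have [C FC ABC] := Fdir A B FA FB.
  exists C => // j; rewrite inE => /predU1P[-> _|js bj]; apply: ABC; first by right.
  by left; exact: As.
by exists A => // i; apply: Ax; rewrite mem_enum.
Qed.

(** The prescribed points are moved into [D], the property of [D] is applied, and the original
    points are put back. Each of the three moves costs [eps / 3]. *)
Lemma almost_ideal_closed (D : set X) : almost_ideal D -> almost_ideal (closure D).
Proof.
move=> Dai k b x eps eps0 bx.
have e3 : 0 < eps / 3 by rewrite divr_gt0.
have /choice[y yP] : forall i, exists z, (b i -> D z) /\ `|x i - z| <= eps / 3.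
  move=> i; have [bi|nbi] := boolP (b i); last by exists (x i); rewrite subrr normr0 ltW.
  have [z [Dz /= zx]] := bx i bi _ (nbhsx_ballx (x i) _ e3).
  by exists z; split => //; rewrite -ball_normE in zx; exact: ltW.
have [y' [y'D y'b y'c]] := Dai k b y _ e3 (fun i => (yP i).1).
exists (fun i => if b i then x i else y' i); split.
- by move=> i; case: ifP => [/bx//|_]; exact: subset_closure.
- by move=> i ->.
- move=> c; set x' := fun i => _.
  have close (u v : 'I_k -> X) : (forall i, `|u i - v i| <= eps / 3) ->
      `| `|lincomb c u| - `|lincomb c v| | <= eps / 3 * \sum_i `|c i|.
    move=> uv; apply: le_trans (ler_dist_dist _ _) _; rewrite -lincombBr.
    apply: le_trans (norm_lincomb _ _) _; rewrite mulr_sumr; apply: ler_sum => i _.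
    by rewrite mulrC ler_wpM2r.
  have := close _ _ (fun i => (yP i).2); have := y'c c.
  have /close : forall i, `|x' i - y' i| <= eps / 3.
    move=> i; rewrite /x'; case: ifP => [bi|_]; last by rewrite subrr normr0 ltW.
    by rewrite y'b//; exact: (yP i).2.
  rewrite !ler_norml => /andP[? ?] /andP[? ?] /andP[? ?]; apply/andP; split; lra.
Qed.

End AlmostIdeal.

(** * Density and the exceedingly rich family *)

Section Density.
Variables (R : realType) (X : normedModType R).
Implicit Types (D Y Z : set X).

Lemma dens_closure_le D : dens (closure D) #<= D.
Proof. by apply: (densP _).2; split => //; exact: subset_closure. Qed.

(** For each [d] in [dens Z] and each [n], a point of [Y] within [1/(n+1)] of [d] is selected if
    there is one. The selected points are dense in [Y], and [finitary_closure] bounds their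
    number. *)
Lemma dens_le Y Z : Y `<=` Z -> infinite_set (dens Z) -> dens Y #<= dens Z.
Proof.
move=> YZ Zinf; have [[_ dZ] _] := densP Z.
pose near_pt (n : nat) (s : seq X) : X :=
  xget 0 (Y `&` ball (head 0 s) n.+1%:R^-1).
have [D [ZD Dop DZ]] := finitary_closure near_pt Zinf.
apply: card_le_trans DZ; apply: card_le_trans (subset_card_le (@subIsetl _ D Y)).
apply: (densP Y).2; split => [|y Yy U /nbhs_ballP[e /= e0 eU]]; first exact: subIsetr.
pose n := Num.truncn (2 / e).
have n0 : 0 < n.+1%:R^-1 :> R by rewrite invr_gt0.
have ne : n.+1%:R^-1 + n.+1%:R^-1 < e.
  have : 2 / e < n.+1%:R by exact: truncnS_gt.
  rewrite ltr_pdivrMr// => h.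
  rewrite (_ : _ + _ = 2 / n.+1%:R); first by rewrite ltr_pdivrMr// mulrC.
  by rewrite -mulr2n mulr_natl.
have [d [Zd yd]] := dZ _ (YZ _ Yy) _ (nbhsx_ballx y _ n0).
pose p := near_pt n [:: d].
have [Yp dp] : (Y `&` ball d n.+1%:R^-1) p.
  by apply: xgetPex; exists y; split => //; exact: ball_sym.
exists p; split; first split => //.
  by apply: Dop => x; rewrite inE => /eqP ->; exact: ZD.
apply: eU; apply: le_ball (ltW ne) _ _.
exact: ball_triangle yd dp.
Qed.

(** A finite set is closed, so a finite dense subset would be all of [E], which contains the
    infinitely many multiples of [w]. *)
Lemma dens_submod_infinite (E : submodClosed X) (w : X) :
  w \in E -> w != 0 -> infinite_set (dens [set` E]).
Proof.
move=> Ew w0 fD; have [[DE ED] _] := densP [set` E].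
have D_closed : closed (dens [set` E]).
  by apply: (@accessible_finite_set_closed X).1 fD; exact/hausdorff_accessible/norm_hausdorff.
have {}ED : [set` E] `<=` dens [set` E] by rewrite -(closure_id _).1 in ED.
apply: infinite_nat; apply: (card_le_finite _ fD).
apply: card_le_trans (subset_card_le ED).
apply/(card_leE 0); exists (fun n => n%:R *: w).
  by move=> n _ /=; rewrite rpredZ.
move=> m n _ _ /eqP; rewrite -subr_eq0 -scalerBl scaler_eq0 (negPf w0) orbF.
by rewrite subr_eq0 eqr_nat => /eqP.
Qed.

(** The combination is adjoined to the [x i], which stay fixed. The linear relation between them is
    almost preserved, so the image of the combination is a point of [D] close to it. *)
Lemma almost_ideal_lincomb D k (c : 'I_k -> R) (x : 'I_k -> X) :
  almost_ideal D -> (forall i, D (x i)) -> closure D (lincomb c x).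
Proof.
move=> Dai Dx U /nbhs_ballP[e /= e0 eU].
pose y (i : 'I_k.+1) := if unlift ord0 i is Some j then x j else lincomb c x.
pose d (i : 'I_k.+1) := if unlift ord0 i is Some j then - c j else 1.
pose s := \sum_i `|d i| + 1.
have s0 : 0 < s by rewrite ltr_wpDl ?sumr_ge0.
have [|i|y' [Dy' y'b]] := Dai k.+1 (fun i => i != ord0) y (e / s).
- by rewrite divr_gt0.
- by rewrite /y; case: unliftP => [j ->|->]; rewrite ?eqxx.
move=> /(_ d); rewrite /lincomb !big_ord_recl.
have -> : d ord0 = 1 by rewrite /d unlift_none.
have -> : y ord0 = lincomb c x by rewrite /y unlift_none.
under eq_bigr do rewrite /d liftK y'b// /y liftK scaleNr.
under [X in _ - `|_ + X|]eq_bigr do rewrite /d /y liftK scaleNr.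
rewrite !sumrN !scale1r subrr normr0 subr0 normr_id => h.
exists (y' ord0); split => //; apply: eU; rewrite -ball_normE /= distrC.
apply: le_lt_trans h _; rewrite mulrAC ltr_pdivrMr// ltr_pM2l//.
by rewrite /s big_ord_recl/= /d unlift_none normr1 ltrDl.
Qed.

(** Closedness turns approximate stability under linear combinations into exact stability;
    combinations of lengths 0 and 2 suffice. *)
Lemma almost_ideal_submod D : closed D -> almost_ideal D ->
  exists E : submodClosed X, [set` E] = D.
Proof.
move=> cD Dai.
have Dlin k (c : 'I_k -> R) (x : 'I_k -> X) : (forall i, D (x i)) -> D (lincomb c x).
  by move=> Dx; rewrite (closure_id D).1//; exact: almost_ideal_lincomb.
pose P : {pred X} := [pred x | x \in D].
have PD : submod_closed P.
  split; rewrite ?inE.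
    by have := Dlin 0%N (fun=> 0) (fun=> 0); rewrite /lincomb big_ord0; apply; case.
  move=> a u v; rewrite !inE => Du Dv.
  have := Dlin 2%N (fun i => if i == ord0 then a else 1)
    (fun i => if i == ord0 then u else v).
  rewrite /lincomb !big_ord_recl big_ord0 /= scale1r addr0; apply => i.
  by case: ifP.
have PD' : subsemimod_closed P.
  exact: GRing.submod_closed_semi PD.
pose E : submodClosed X := HB.pack P (GRing.isSubmodClosed.Build R X P PD').
by exists E; apply/seteqP; split => x /=; rewrite -[x \in E]/(x \in D) inE.
Qed.

(* A plain function rather than a set comprehension, for universe reasons. *)
Definition almost_ideals_over (W : set X) : set (submodClosed X) := fun E =>
  [/\ closed [set` E], W `<=` [set` E] & almost_ideal [set` E]].

(** For (R-a), a dense subset of [Y] together with [W] is enlarged to an almost ideal of the same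
    infinite cardinality, whose closure is taken. The nonzero [w] keeps the density of every member
    infinite. *)
Lemma almost_ideals_exceedingly_rich (W : set X) (w : X) :
  countable W -> W w -> w != 0 ->
  exceedingly_rich [set [set` E] | E in almost_ideals_over W].
Proof.
move=> cW Ww w0; split.
- by move=> _ [Y [cY _ _] <-].
- move=> Y.
  pose op (n : nat) (s : seq X) : X := if s is x :: _ then n%:R *: x else w.
  (* The multiples of [w] make [A] infinite at the cost of countably many points. *)
  have [A [YA WA Ainf Acard]] : exists A : set X, [/\ dens Y `<=` A, W `<=` A,
      infinite_set A & (finite_set (dens Y) /\ countable A) \/
        (infinite_set (dens Y) /\ A #<= dens Y)].
    have NW : infinite_set (range (fun n => n%:R *: w)).
      apply/infiniteP/(card_leE 0); exists (fun n => n%:R *: w).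
        by move=> n _; exists n.
      move=> m n _ _ /eqP; rewrite -subr_eq0 -scalerBl scaler_eq0 (negPf w0) orbF.
      by rewrite subr_eq0 eqr_nat => /eqP.
    pose V := W `|` range (fun n => n%:R *: w).
    have cV : countable V by apply: countable_setU => //; exact: card_image_le.
    have VI : infinite_set V by apply: sub_infinite_set NW; exact: subsetUr.
    exists (dens Y `|` V); split.
    - exact: subsetUl.
    - by move=> x Wx; right; left.
    - by apply: sub_infinite_set VI; exact: subsetUr.
    have [fY|iY] := pselect (finite_set (dens Y)); [left|right]; split => //.
      by apply: countable_setU => //; exact: finite_set_countable.
    exact: infinite_setU_card.
  have [D [AD Dai DA]] := almost_ideal_closure Ainf.
  have cDai := almost_ideal_closed Dai.
  have [E ED] := almost_ideal_submod (@closed_closure _ _) cDai.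
  have WE : W `<=` [set` E].
    by rewrite ED; apply: subset_trans WA _; apply: subset_trans AD _; exact: subset_closure.
  have DEA : dens [set` E] #<= A by rewrite ED; exact: card_le_trans (dens_closure_le _) DA.
  have YE : Y `<=` [set` E].
    rewrite ED; have [[_ YdY] _] := densP Y; apply: subset_trans YdY _.
    by apply: closure_subset; exact: subset_trans YA AD.
  have Einf := dens_submod_infinite (WE _ Ww) w0.
  exists [set` E]; first by exists E => //; split => //; rewrite ED//; exact: closed_closure.
  split => //; case: Acard => [[fY cA]|[iY AY]]; [left|right].
    split; first exact: finite_set_countable.
    by rewrite card_eq_le (card_le_trans DEA cA); exact/infiniteP.
  split; first exact/infiniteP.
  by rewrite card_eq_le (card_le_trans DEA AY) dens_le.
- move=> F FS [[A0 FA0] Fdir].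
  have Fai A : F A -> almost_ideal A by move=> /FS[Y [_ _ ?] <-].
  have cDai := almost_ideal_closed (almost_ideal_bigcup (conj (ex_intro _ _ FA0) Fdir) Fai).
  have [E ED] := almost_ideal_submod (@closed_closure _ _) cDai.
  exists E => //; split; rewrite ED//; first exact: closed_closure.
  apply: subset_trans (@subset_closure _ _); have [Y [_ WY _] YA0] := FS _ FA0.
  by rewrite YA0 in WY => x /WY A0x; exists A0.
Qed.

End Density.

(** * Bases of finite-dimensional spaces *)

Section AdaptedBasis.
Variables (R : realType) (F : normedModType R).

Definition independent (s : seq F) := forall c : nat -> R,
  \sum_(i < size s) c i *: s`_i = 0 -> forall i, (i < size s)%N -> c i = 0.

(** With more vectors than generators, the coordinate matrix has more rows than columns; a nonzero
    row vector in its left kernel is a linear dependence. *)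
Lemma independent_size n (e : 'I_n -> F) :
  (forall x, exists c : 'I_n -> R, x = \sum_i c i *: e i) ->
  forall s, independent s -> (size s <= n)%N.
Proof.
move=> gen s sI; rewrite leqNgt; apply/negP => ns.
have /choice[c cP] := fun i : 'I_(size s) => gen s`_i.
pose M := \matrix_(i, j) c i j.
have : kermx M != 0.
  rewrite kermx_eq0 -row_leq_rank -ltnNge.
  exact: leq_ltn_trans (rank_leq_col _) ns.
case/rowV0Pn => v /sub_kermxP vM /eqP; apply; apply/rowP => i; rewrite mxE.
pose a (j : nat) := if insub j is Some j' then v 0 j' else 0.
have aE (j : 'I_(size s)) : a j = v 0 j by rewrite /a valK.
rewrite -aE; apply: sI => //.
under eq_bigr do rewrite aE cP scaler_sumr.
rewrite exchange_big big1// => j _ /=.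
under eq_bigr do rewrite scalerA.
rewrite -scaler_suml (_ : \sum_i _ = 0) ?scale0r//.
have /matrixP/(_ 0 j) := vM; rewrite !mxE => vMj; rewrite -[RHS]vMj.
by apply: eq_bigr => i' _; rewrite mxE.
Qed.

(** The number of generators bounds the length of independent lists, so there is a longest extension
    by vectors of [P]. Adding a further [x] in [P] creates a dependence, which is solved for [x]. *)
Lemma independent_extension (P : set F) (s0 : seq F) :
  finite_dimensional F -> independent s0 ->
  exists s, [/\ independent (s0 ++ s), forall x, x \in s -> P x &
    forall x, P x -> exists c : nat -> R,
      x = \sum_(i < size (s0 ++ s)) c i *: (s0 ++ s)`_i].
Proof.
move=> [n [e gen]] s0I.
pose Q m := `[< exists s, [/\ size s = m, independent (s0 ++ s) &
  forall x, x \in s -> P x] >].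
have Q0 : exists m, Q m by exists 0%N; apply/asboolP; exists [::]; rewrite cats0.
have Qn m : Q m -> (m <= n)%N.
  move=> /asboolP[s [<- sI _]]; have := independent_size gen sI.
  by rewrite size_cat; apply: leq_trans; exact: leq_addl.
case: (ex_maxnP Q0 Qn) => m /asboolP[s [sm sI sP]] mmax.
exists s; split => // x Px; set t := s0 ++ s.
have : ~ independent (rcons t x).
  move=> xI; have /mmax : Q m.+1; last by rewrite ltnn.
  apply/asboolP; exists (rcons s x); rewrite size_rcons sm -rcons_cat; split => //.
  by move=> y; rewrite mem_rcons inE => /predU1P[->|/sP].
move=> /existsNP[c] /not_implyP[]; rewrite size_rcons big_ord_recr /=.
rewrite nth_rcons ltnn eqxx.
under eq_bigr do rewrite nth_rcons ltn_ord.
move=> sum0 /existsNP[i] /not_implyP[it ci].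
(* A relation in which [x] has coefficient 0 would be a relation of the independent list [t], hence
   trivial. *)
have [cx0|cx0] := eqVneq (c (size t)) 0.
  exfalso; apply: ci; move: it; rewrite ltnS leq_eqVlt => /predU1P[->//|it].
  by apply: (sI c) => //; rewrite cx0 scale0r addr0 in sum0.
exists (fun i => - (c i / c (size t))).
apply: (scalerI cx0); rewrite scaler_sumr.
apply/eqP; rewrite -subr_eq0 -sumrN addrC -[X in _ == X]sum0; apply/eqP.
congr (_ + _); apply: eq_bigr => j _.
by rewrite scalerA mulrN scaleNr opprK mulrCA divff// mulr1.
Qed.

(** A basis of [E] is completed to one of [F]. By uniqueness of coordinates, a vector of [E]
    involves only the basis vectors in [E]. *)
Lemma adapted_basis (E : submodClosed F) : finite_dimensional F ->
  exists k (w : 'I_k -> F), [/\ forall x, exists c, x = lincomb c w,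
    forall c, lincomb c w = 0 -> forall i, c i = 0 &
    forall c i, lincomb c w \in E -> c i != 0 -> w i \in E].
Proof.
move=> Ffd.
have nilI : independent [::] by [].
have [s [sI sE Es]] := independent_extension [set` E] Ffd nilI.
have [t [tI _ Ft]] := independent_extension setT Ffd sI.
rewrite /= in sI sE Es.
have ext (c : 'I_(size (s ++ t)) -> R) :
    exists d : nat -> R, forall i : 'I_(size (s ++ t)), d i = c i.
  exists (fun j => if insub j is Some j' then c j' else 0) => i.
  by rewrite valK.
exists (size (s ++ t)), (fun i => (s ++ t)`_i); split.
- by move=> x; have [c ->] := Ft x Logic.I; exists (fun i => c i).
- move=> c; have [d dc] := ext c; rewrite /lincomb.
  by under eq_bigr do rewrite -dc; move=> /tI d0 i; rewrite -dc d0.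
- move=> c i /Es[d]; have [b bc] := ext c; rewrite /lincomb.
  under [in X in X = _ -> _]eq_bigr do rewrite -bc.
  move=> bd; rewrite -bc => bi; rewrite nth_cat; case: ifPn => [si|]; first by apply: sE; exact: mem_nth.
  rewrite -leqNgt => si; exfalso; move/eqP: bi; apply.
  pose d' j := if (j < size s)%N then d j else 0.
  have <- : b i - d' i = b i by rewrite /d' ltnNge si subr0.
  apply: (tI (fun j => b j - d' j)) => //=.
  under eq_bigr do rewrite scalerBl.
  rewrite sumrB bd; apply/eqP; rewrite subr_eq0; apply/eqP.
  rewrite size_cat big_split_ord /= [X in _ + X]big1 ?addr0.
    by apply: eq_bigr => j _; rewrite /d' nth_cat ltn_ord.
  by move=> j _; rewrite /d' ltnNge leq_addr scale0r.
Qed.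

(** On the compact l1-sphere the norm of the combination attains a minimum, positive by
    independence; [C] is its inverse. For [k = 0] the sphere is empty, hence the separate case. *)
Lemma l1norm_le_lincomb k (w : 'I_k -> F) :
  (forall c, lincomb c w = 0 -> forall i, c i = 0) ->
  exists2 C, 0 < C & forall c, \sum_i `|c i| <= C * `|lincomb c w|.
Proof.
move=> wI; case: k w wI => [|k] w wI.
  by exists 1 => // c; rewrite big_ord0 mul1r.
pose l1 (v : 'rV[R]_k.+1) := \sum_i `|v ord0 i|.
pose f (v : 'rV[R]_k.+1) := `|lincomb (v ord0) w|.
have l1C : continuous l1.
  apply: continuous_big; first exact: add_continuous.
  move=> i _ v; apply: (@continuous_comp _ _ _ (fun v : 'rV[R]_k.+1 => v ord0 i) Num.norm).
    exact: coord_continuous.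
  exact: norm_continuous.
have fC : continuous f.
  move=> v; apply: (@continuous_comp _ _ _ (fun v : 'rV[R]_k.+1 => lincomb (v ord0) w) Num.norm).
    apply: continuous_big; first exact: add_continuous.
    move=> i _ u.
    apply: (@continuous_comp _ _ _ (fun v : 'rV[R]_k.+1 => v ord0 i) (fun r : R => r *: w i)).
      exact: coord_continuous.
    exact: scalel_continuous.
  exact: norm_continuous.
pose S := l1 @^-1` [set 1].
have S1 v i : S v -> `|v ord0 i| <= 1.
  by move=> <-; rewrite /l1 (bigD1 i)//= lerDl sumr_ge0.
have cS : compact S.
  apply: (@subclosed_compact _ _ [set v : 'rV[R]_k.+1 | forall i, v ord0 i \in `[-1, 1]]).
  - by apply: (continuous_closedP _).1 l1C _ _; exact: closed_eq.
  - apply: (@rV_compact _ k.+1 (fun=> `[(-1), 1]%classic : set R)) => i; exact: segment_compact.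
  - by move=> v Sv i /=; rewrite in_itv /= -ler_norml; exact: S1.
have S0 : S !=set0.
  exists (delta_mx 0 0); rewrite /S /l1 /= (bigD1 ord0)//= mxE !eqxx normr1 big1 ?addr0//.
  by move=> i /negPf i0; rewrite mxE i0 andbF normr0.
have [v vS vmin] := EVT_min_rV S0 cS (continuous_subspaceT fC).
have fv0 : 0 < f v.
  rewrite normr_gt0; apply/eqP => /wI v0; move: vS; rewrite inE /S /= /l1.
  by rewrite big1 => [/eqP|i _]; rewrite ?v0 ?normr0// eq_sym oner_eq0.
exists (f v)^-1; first by rewrite invr_gt0.
move=> c; set s := \sum_i _.
have [->|s0] := eqVneq s 0; first by rewrite mulr_ge0// invr_ge0 ltW.
have sp : 0 < s by rewrite lt_neqAle eq_sym s0 sumr_ge0.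
pose u : 'rV[R]_k.+1 := \row_i (s^-1 * c i).
have uS : u \in S.
  rewrite inE /S /= /l1; under eq_bigr do rewrite mxE normrM.
  by rewrite -mulr_sumr normfV gtr0_norm// mulVf.
have -> : `|lincomb c w| = s * f u.
  rewrite /f (_ : lincomb (u ord0) w = s^-1 *: lincomb c w).
    by rewrite normrZ normfV gtr0_norm// mulVKf.
  by rewrite -lincombZl; apply: eq_bigr => i _; rewrite mxE.
rewrite mulrCA ler_peMr ?(ltW sp)// mulrC ler_pdivlMr// mul1r.
exact: vmin.
Qed.

End AdaptedBasis.

Lemma val_lincomb (R : realType) (V : normedModType R) (E : submodClosed V) k
    (c : 'I_k -> R) (x : 'I_k -> submod E) :
  val (lincomb c x) = lincomb c (fun i => val (x i)).
Proof. by rewrite raddf_sum; apply: eq_bigr => i _; exact: linearZ. Qed.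

(** * Lifting operators into almost isometric ideals *)

Section Lift.
Variables (R : realType) (X : normedModType R) (Y : submodClosed X).

(** The images of an adapted basis are moved into [Y], those of basis vectors in [E] being kept. The
    new operator therefore agrees with [T] on all of [E]. *)
Lemma lift_into_almost_ideal (F : normedModType R) (E : submodClosed F)
    (T : {linear F -> X}) (eps : R) :
  almost_ideal [set` Y] -> finite_dimensional F -> 0 < eps ->
  (forall x, x \in E -> T x \in Y) ->
  exists T' : {linear F -> submod Y},
    (forall x, x \in E -> val (T' x) = T x) /\
    forall x, `| `|T' x| - `|T x| | <= eps * `|x|.
Proof.
move=> Yai Ffd eps0 TEY.
have [k [w [/choice[co coP] wI wE]]] := adapted_basis E Ffd.
have [C C0 wC] := l1norm_le_lincomb wI.
have co_uniq c x : x = lincomb c w -> co x = c.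
  move=> xc; apply/funext => i; apply/eqP; rewrite -subr_eq0; apply/eqP.
  by apply: (wI (fun i => co x i - c i)); rewrite lincombBl -coP -xc subrr.
(* An error [eps / C] relative to the l1-norm of the coordinates is at most [eps] relative to the
   norm of the vector. *)
have [||x' [x'Y x'E x'c]] := Yai k (fun i => w i \in E) (T \o w) (eps / C).
- by rewrite divr_gt0.
- by move=> i /TEY.
pose z i : submod Y := exist _ (x' i) (x'Y i).
pose f x := lincomb (co x) z.
have fL : linear f.
  move=> a u v; rewrite /f -lincombZl -lincombDl; congr lincomb.
  by apply: co_uniq; rewrite lincombDl lincombZl -!coP.
pose f' : {linear F -> submod Y} := HB.pack f (GRing.isLinear.Build _ _ _ _ f fL).
have valf x : val (f' x) = lincomb (co x) x' by rewrite val_lincomb.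
exists f'; split => [x Ex|x].
  rewrite valf [in RHS](coP x) linear_lincomb; apply: eq_bigr => i _.
  have [->|ci] := eqVneq (co x i) 0; first by rewrite !scale0r.
  by rewrite x'E//; apply: (wE (co x)); rewrite -?coP.
rewrite submod_normE valf [in X in _ - X](coP x) linear_lincomb.
apply: le_trans (x'c _) _; rewrite -mulrA ler_wpM2l ?(ltW eps0)//.
by rewrite mulrC ler_pdivrMr// mulrC; have := wC (co x); rewrite -coP.
Qed.

Lemma fin_spanned (F : normedModType R) (E : submodClosed F) :
  finite_dimensional F -> exists k (w : 'I_k -> submod E),
    forall x, exists c, x = lincomb c w.
Proof.
move=> Ffd; have nilI : independent (@nil F) by move=> c _ i.
have [s [_ sE Es]] := independent_extension [set` E] Ffd nilI.
have sE' (i : 'I_(size s)) : s`_i \in E by apply: sE; exact: mem_nth.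
exists (size s), (fun i : 'I_(size s) => exist _ s`_i (sE' i)) => x.
have [c xc] := Es (val x) (valP x); exists (fun i : 'I_(size s) => c i); apply: val_inj.
by rewrite val_lincomb xc.
Qed.

End Lift.

(** * The two extension properties *)

(* The common form of the Gurarii and the L1-predual property: [P eps n t]
   constrains the norm [t] of the image of a vector of norm [n]. *)
Definition extension_property (R : realType) (P : R -> R -> R -> Prop)
    (X : normedModType R) :=
  forall eps : R, 0 < eps ->
  forall F : normedModType R, finite_dimensional F ->
  forall (E : submodClosed F) (T : {linear submod E -> X}),
    (forall x, `|T x| = `|x|) ->
  exists That : {linear F -> X},
    (forall x : submod E, That (val x) = T x) /\
    (forall x, P eps `|x| `|That x|).

Section ExtensionProperty.
Variables (R : realType) (P : R -> R -> R -> Prop) (X : normedModType R).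

(** The operator is extended into [X] with a better constant [d] and then lifted into [Y] without
    changing it on [E]. The hypothesis on [P] absorbs the error of the lift. *)
Lemma extension_property_almost_ideal (Y : submodClosed X) :
  (forall eps, 0 < eps -> exists2 d, 0 < d & forall n t t', 0 <= n ->
    P d n t -> `|t' - t| <= d * n -> P eps n t') ->
  almost_ideal [set` Y] ->
  extension_property P X -> extension_property P (submod Y).
Proof.
move=> Pc Yai PX eps eps0 F Ffd E T Tiso.
have [d d0 Pd] := Pc eps eps0.
have TL : linear (fun x => val (T x)) by move=> a u v; rewrite linearP.
pose T1 : {linear submod E -> X} :=
  HB.pack (fun x => val (T x)) (GRing.isLinear.Build _ _ _ _ _ TL).
have [S [SE SP]] := PX d d0 F Ffd E T1 Tiso.
have SY x : x \in E -> S x \in Y.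
  by move=> Ex; have /= -> := SE (exist _ x Ex); exact: valP.
have [S' [S'E S'P]] := lift_into_almost_ideal Yai Ffd d0 SY.
exists S'; split => [x|x]; last exact: Pd (SP x) (S'P x).
by apply: val_inj; rewrite S'E ?SE//; exact: valP.
Qed.

(** [W] is the image of a spanning family of [E] under an operator without extension. If [Y]
    contains [W], this operator maps into [Y], and an extension into [Y] would be one into [X]. *)
Lemma extension_property_countable_witness : ~ extension_property P X ->
  exists2 W : set X, countable W & forall Y : submodClosed X,
    W `<=` [set` Y] -> ~ extension_property P (submod Y).
Proof.
move=> /existsNP[eps] /not_implyP[eps0] /existsNP[F] /not_implyP[Ffd].
move=> /existsNP[E] /existsNP[T] /not_implyP[Tiso noT].
have [k [w wE]] := fin_spanned E Ffd.
exists (range (T \o w)); first exact/finite_set_countable/finite_image/finite_finset.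
move=> Y WY PY; apply: noT.
have TY x : T x \in Y.
  have [c ->] := wE x; rewrite linear_lincomb; apply: rpred_sum => i _.
  by rewrite rpredZ//; apply: WY; exists i.
pose f x : submod Y := exist _ (T x) (TY x).
have fL : linear f by move=> a u v; apply: val_inj; rewrite linearP /= linearP.
pose f' : {linear submod E -> submod Y} := HB.pack f (GRing.isLinear.Build _ _ _ _ _ fL).
have [S [SE SP]] := PY eps eps0 F Ffd E f' Tiso.
have SL : linear (fun x => val (S x)) by move=> a u v; rewrite linearP.
pose S1 : {linear F -> X} :=
  HB.pack (fun x => val (S x)) (GRing.isLinear.Build _ _ _ _ _ SL).
exists S1; split => [x|x]; last exact: SP.
by rewrite /= SE.
Qed.

End ExtensionProperty.

Lemma gurariiE (R : realType) (X : normedModType R) : gurarii X =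
  extension_property (fun eps n t => (1 + eps)^-1 * n <= t <= (1 + eps) * n) X.
Proof. by []. Qed.

Lemma L1_predualE (R : realType) (X : normedModType R) : L1_predual X =
  extension_property (fun eps n t => t <= (1 + eps) * n) X.
Proof. by []. Qed.

Lemma gurarii_almost_ideal (R : realType) (X : normedModType R) (Y : submodClosed X) :
  almost_ideal [set` Y] -> gurarii X -> gurarii (submod Y).
Proof.
move=> Yai; rewrite !gurariiE; apply: extension_property_almost_ideal Yai => eps eps0.
have eps1 : 0 < 1 + eps by rewrite addr_gt0.
(* With this [d], [(1 - 2d)(1 + eps) = 1]. The extension has lower bound [(1 + d)^-1 >= 1 - d], and
   the lift loses a further [d]. *)
pose d := eps / (1 + eps) / 2.
have d0 : 0 < d by rewrite !divr_gt0.
have dE : d * 2 * (1 + eps) = eps by rewrite /d divfK// divfK ?gt_eqF.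
exists d => // n t t' n0 /andP[nt tn]; rewrite ler_norml => /andP[tt' t't].
have {nt} nt : n <= (1 + d) * t by rewrite mulrC -ler_pdivrMr ?addr_gt0// mulrC.
have {nt} nt : (1 - d) * n <= t.
  rewrite -(ler_pM2l (_ : 0 < 1 + d)) ?addr_gt0//; apply: le_trans nt.
  have : 0 <= d * d * n by apply: mulr_ge0 => //; apply: mulr_ge0; exact: ltW.
  by lra.
have epsd : d * 2 * n <= eps * n.
  rewrite ler_wpM2r// -[leRHS]dE; have := mulr_ge0 (ltW d0) (ltW eps0); lra.
apply/andP; split; last by lra.
rewrite mulrC ler_pdivrMr//.
have : (1 - d * 2) * n * (1 + eps) <= t' * (1 + eps).
  by rewrite (ler_wpM2r (ltW eps1))//; lra.
apply: le_trans; rewrite mulrAC [_ * (1 + eps)]mulrBl dE mul1r addrK mul1r.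
exact: lexx.
Qed.

Lemma L1_predual_almost_ideal (R : realType) (X : normedModType R) (Y : submodClosed X) :
  almost_ideal [set` Y] -> L1_predual X -> L1_predual (submod Y).
Proof.
move=> Yai; rewrite !L1_predualE; apply: extension_property_almost_ideal Yai => eps eps0.
exists (eps / 2); first by rewrite divr_gt0.
by move=> n t t' n0 tn; rewrite ler_norml => /andP[_ ?]; lra.
Qed.

(** * Ultralimits and the extension of functionals *)

Lemma le_small_error (R : realType) (a b C : R) : 0 <= C ->
  (forall eps, 0 < eps <= 1 -> a <= b + eps * C) -> a <= b.
Proof.
move=> C0 abC; apply/ler_addgt0Pr => e e0.
have C1 : 0 < C + 1 by rewrite ltr_wpDl.
pose d := Num.min 1 (e / (C + 1)).
have d0 : 0 < d by rewrite lt_min ltr01 divr_gt0.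
apply: le_trans (abC d _) _; first by rewrite d0 ge_min lexx.
rewrite lerD2l; apply: (@le_trans _ _ (e / (C + 1) * (C + 1))); last by rewrite divfK ?gt_eqF.
by rewrite ler_pM ?(ltW d0)// ?lerDl// ge_min lexx orbT.
Qed.

Lemma le_any_error (R : realType) (a b : R) (C : R) : 0 <= C ->
  (forall eps, 0 < eps <= 1 -> `|a - b| <= eps * C) -> a = b.
Proof.
move=> C0 abC; apply/eqP; rewrite -subr_eq0 -normr_eq0 eq_le normr_ge0 andbT.
by apply: (le_small_error C0) => e /abC; rewrite add0r.
Qed.

(** The limits are taken along an ultrafilter finer than [F]. Finitely many functions are then close
    to their limits at a common index in any prescribed set of [F]. *)
Lemma simultaneous_limit (R : realType) (T : eqType) (I : Type) (F : set_system I)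
    (h : T -> I -> R) (M : T -> R) :
  ProperFilter F -> (forall t, F [set i | `|h t i| <= M t]) ->
  exists l : T -> R, forall A, F A -> forall (s : seq T) eps, 0 < eps ->
    exists2 i, A i & forall t, t \in s -> `|h t i - l t| <= eps.
Proof.
move=> FF hM; have [G [GU FG]] := ultraFilterLemma FF.
have /choice[l lP] : forall t, exists l, forall eps, 0 < eps ->
    G [set i | `|h t i - l| <= eps].
  move=> t; have [|l [_ lcl]] := @segment_compact R (- M t) (M t) (h t @ G).
    suff : G (h t @^-1` `[- M t, M t]) by [].
    by apply: filterS (FG _ (hM t)) => i /=; rewrite in_itv /= ler_norml.
  (* Otherwise the complement would lie in [G], and since [l] is a cluster point, some index of the
     complement would have its value near [l]. *)
  exists l => eps eps0; have [//|nG] := in_ultra_setVsetC [set i | `|h t i - l| <= eps] GU.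
  have [r [[i /= ni <-] lr]] : ((h t @` (~` [set i | `|h t i - l| <= eps])) `&` ball l eps) !=set0.
    apply: lcl; last exact: nbhsx_ballx.
    suff : G (h t @^-1` (h t @` (~` [set i | `|h t i - l| <= eps]))) by [].
    by apply: filterS nG => i ni; exists i.
  by exfalso; apply: ni; rewrite -ball_normE /= distrC in lr; exact: ltW.
exists l => A /FG GA s eps eps0.
suff : G [set i | A i /\ forall t, t \in s -> `|h t i - l t| <= eps].
  by move=> /filter_ex[i [Ai his]]; exists i.
elim: s => [|t s IH]; first by apply: filterS GA => i Ai; split.
apply: filterS2 (lP t _ eps0) IH => i /= hti [Ai his]; split => // u.
by rewrite inE => /predU1P[->|/his].
Qed.

Section FunctionalExtension.
Variables (R : realType) (X : normedModType R) (Y : submodClosed X).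

(** [Q] need not be linear. Combinations of three vectors suffice to test the relation between [u],
    [w] and [a *: u + w]. *)
Definition near_isometry (s : seq X) (eps : R) : set (X -> submod Y) :=
  [set Q : X -> submod Y | (forall x, x \in Y -> x \in s -> val (Q x) = x) /\
    forall x y z, x \in s -> y \in s -> z \in s -> forall a b c,
      `| `|a *: Q x + b *: Q y + c *: Q z| - `|a *: x + b *: y + c *: z| | <=
        eps * (`|a| + `|b| + `|c|)].

Lemma near_isometry_ex s eps : almost_ideal [set` Y] -> 0 < eps ->
  near_isometry s eps !=set0.
Proof.
move=> Yai eps0; pose u := undup s; pose k := size u.
have [|x' [x'Y x'b x'c]] := Yai k (fun i => u`_i \in Y) (fun i => u`_i) eps eps0.
  by [].
pose z (i : 'I_k) : submod Y := exist _ (x' i) (x'Y i).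
pose Q x : submod Y := if insub (index x u) is Some i then z i else 0.
have QE x : x \in s -> exists2 i : 'I_k, Q x = z i & u`_i = x.
  rewrite -mem_undup => xs; have ik : (index x u < k)%N by rewrite index_mem.
  by exists (Ordinal ik); rewrite /= ?nth_index// /Q insubT.
exists Q; split.
  by move=> x Yx /QE[i -> uix]; rewrite /= x'b uix.
move=> x y w /QE[i -> <-] /QE[j -> <-] /QE[l -> <-] a b c.
pose cf m : R := a * (m == i)%:R + b * (m == j)%:R + c * (m == l)%:R.
have cfE (V : lmodType R) (v : 'I_k -> V) : lincomb cf v = a *: v i + b *: v j + c *: v l.
  by rewrite !lincombDl !lincombZl !lincomb_delta.
rewrite -(cfE (submod Y) z) -(cfE X (fun m => u`_m)) submod_normE val_lincomb.
apply: le_trans (x'c _) _; rewrite ler_wpM2l ?(ltW eps0)//.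
have delta1 (d : R) m : \sum_(p < k) `|d| * (p == m)%:R = `|d|.
  by rewrite -mulr_sumr (bigD1 m)//= eqxx big1 ?addr0 ?mulr1// => p /negPf ->.
rewrite -(delta1 a i) -(delta1 b j) -(delta1 c l) -!big_split/=.
apply: ler_sum => m _; rewrite /cf.
apply: le_trans (ler_normD _ _) _; apply: lerD; last by rewrite normrM normr_nat.
by apply: le_trans (ler_normD _ _) _; apply: lerD; rewrite normrM normr_nat.
Qed.

Lemma functional_extension (g : {linear submod Y -> R}) B K (v : submod Y) :
  almost_ideal [set` Y] -> 0 <= B -> 0 <= K -> (forall y, `|g y| <= B * `|y|) ->
  (forall y, `|y - g y *: v| <= K * `|y|) ->
  exists gX : {linear X -> R}, [/\ forall y, gX (val y) = g y,
    forall x, `|gX x| <= B * `|x| &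
    forall x, `|x - gX x *: val v| <= K * `|x|].
Proof.
move=> Yai B0 K0 gB gK.
pose F : set_system (X -> submod Y) := [set A | exists s, exists2 eps, 0 < eps &
  near_isometry s eps `<=` A].
have near_isoS s s' eps eps' : {subset s <= s'} -> eps' <= eps ->
    near_isometry s' eps' `<=` near_isometry s eps.
  move=> ss' ee Q [Qfix Qiso]; split; first by move=> x Yx /ss'; exact: Qfix.
  move=> x y z /ss' xs /ss' ys /ss' zs a b c.
  by apply: le_trans (Qiso _ _ _ xs ys zs a b c) _; rewrite ler_wpM2r ?addr_ge0.
have FF : ProperFilter F.
  split; first by move=> [s [eps /(near_isometry_ex s Yai)[Q Qiso] /(_ Q Qiso)]].
  split.
  - by exists [::], 1.
  - move=> A A' [s [e e0 sA]] [s' [e' e'0 sA']]; exists (s ++ s'), (Num.min e e').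
      by rewrite lt_min e0.
    move=> Q Qiso; split; [apply: sA|apply: sA'].
      by apply: near_isoS Qiso; [move=> x; rewrite mem_cat => ->|rewrite ge_min lexx].
    by apply: near_isoS Qiso; [move=> x; rewrite mem_cat orbC => ->|rewrite ge_min lexx orbT].
  - by move=> A A' AA' [s [e e0 sA]]; exists s, e => //; exact: subset_trans sA AA'.
have QN Q s eps x : near_isometry s eps Q -> x \in s -> `|Q x| <= `|x| + eps.
  move=> [_ Qiso] xs; have := Qiso x x x xs xs xs 1 0 0.
  by rewrite !scale0r !addr0 !scale1r !normr0 !addr0 normr1 mulr1 ler_norml => /andP[_]; lra.
have [|gX gXP] := @simultaneous_limit R X _ F (fun x Q => g (Q x))
  (fun x => B * (`|x| + 1)) FF.
  move=> x; exists [:: x], 1 => // Q Qiso /=; apply: le_trans (gB _) _.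
  by rewrite ler_wpM2l//; apply: QN Qiso _; rewrite inE.
have {}gXP s eps : 0 < eps -> exists2 Q, near_isometry s eps Q &
    forall t, t \in s -> `|g (Q t) - gX t| <= eps.
  by move=> eps0; apply: gXP => //; exists s, eps.
have gXg y : gX (val y) = g y.
  apply: (@le_any_error _ _ _ 1) => // eps /andP[eps0 _].
  have [Q [Qfix _] Qg] := gXP [:: val y] eps eps0.
  have Qy : Q (val y) = y by apply: val_inj; apply: Qfix; rewrite ?inE//; exact: valP.
  by have := Qg (val y); rewrite Qy inE eqxx distrC mulr1; exact.
have gXL : linear gX.
  move=> a u w; apply: (@le_any_error _ _ _ ((B + 1) * (`|a| + 2))).
    by rewrite mulr_ge0// addr_ge0.
  move=> eps /andP[eps0 _].
  have [Q [_ Qiso] Qg] := gXP [:: u; w; a *: u + w] eps eps0.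
  have sE : [/\ a *: u + w \in [:: u; w; a *: u + w], u \in [:: u; w; a *: u + w] &
      w \in [:: u; w; a *: u + w]] by rewrite !inE !eqxx ?orbT.
  have [sauw su sw] := sE.
  have QL : `|Q (a *: u + w) - a *: Q u - Q w| <= eps * (`|a| + 2).
    have := Qiso _ _ _ sauw su sw 1 (- a) (-1).
    rewrite !scale1r !scaleNr !scale1r (_ : a *: u + w - a *: u - w = 0); last first.
      by rewrite addrAC addrK subrr.
    rewrite normr0 subr0 normr_id !normrN normr1 => /le_trans; apply.
    by rewrite ler_wpM2l ?(ltW eps0)//; lra.
  have := le_trans (gB _) (ler_wpM2l B0 QL).
  rewrite !linearB linearZ /= -[a *: g (Q u)]/(a * g (Q u)) -[a *: gX u]/(a * gX u) => gQL.
  have := Qg _ sauw; have := Qg _ sw; have := Qg _ su.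
  move=> /(ler_wpM2l (normr_ge0 a)); rewrite -normrM => Qgu Qgw Qgauw.
  rewrite (_ : gX _ - _ = (g (Q (a *: u + w)) - a * g (Q u) - g (Q w)) +
    a * (g (Q u) - gX u) + (g (Q w) - gX w) - (g (Q (a *: u + w)) - gX (a *: u + w))).
    apply: le_trans (ler_normB _ _) _; apply: le_trans (lerD (ler_normD _ _) (lexx _)) _.
    apply: le_trans (lerD (lerD (ler_normD _ _) (lexx _)) (lexx _)) _.
    lra.
  lra.
pose gX' : {linear X -> R} := HB.pack gX (GRing.isLinear.Build _ _ _ _ _ gXL).
exists gX'; split => // x /=.
  apply: (@le_small_error _ _ _ (B + 1)); first by rewrite addr_ge0.
  move=> eps /andP[eps0 _].
  have [Q Qiso Qg] := gXP [:: x] eps eps0.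
  have xx : x \in [:: x] by rewrite inE.
  have := Qg x xx; rewrite distrC => Qgx.
  have := le_trans (gB (Q x)) (ler_wpM2l B0 (QN _ _ _ _ Qiso xx)).
  have := ler_normD (gX x - g (Q x)) (g (Q x)); rewrite subrK.
  lra.
set nv := `|v|.
apply: (@le_small_error _ _ _ (K + (B * (`|x| + 1) + nv + 1))).
  by rewrite !addr_ge0 ?mulr_ge0 ?addr_ge0 ?normr_ge0.
move=> eps /andP[eps0 eps1].
have [Q Qiso Qg] := gXP [:: x; val v] eps eps0.
have sx : x \in [:: x; val v] by rewrite !inE eqxx.
have sv : val v \in [:: x; val v] by rewrite !inE eqxx orbT.
have Qv : Q (val v) = v by apply: val_inj; apply: (proj1 Qiso); rewrite ?(valP v).
have Qx := QN _ _ _ _ Qiso sx.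
have gQx : `|g (Q x)| <= B * (`|x| + 1).
  apply: le_trans (gB _) _; rewrite ler_wpM2l//; apply: le_trans Qx _.
  by rewrite lerD2l.
have := (proj2 Qiso) _ _ _ sx sv sv 1 (- g (Q x)) 0.
rewrite Qv !scale0r !addr0 !scale1r !scaleNr normr1 normr0 normrN addr0 ler_norml => /andP[h _].
have h1 : `|x - g (Q x) *: val v| <= K * (`|x| + eps) + eps * (1 + B * (`|x| + 1)).
  have := gK (Q x); have := ler_wpM2l K0 Qx; have := ler_wpM2l (ltW eps0) gQx; lra.
have h2 : `|g (Q x) *: val v - gX x *: val v| <= eps * nv.
  by rewrite -scalerBl normrZ ler_wpM2r//; exact: Qg.
have := ler_normD (x - g (Q x) *: val v) (g (Q x) *: val v - gX x *: val v).
rewrite addrA subrK; lra.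
Qed.

End FunctionalExtension.

Section Daugavet.
Variables (R : realType) (X : normedModType R).
Implicit Types f : X -> X.

Lemma le_opnorm f x : bounded_operator f -> `|x| <= 1 -> `|f x| <= opnorm f.
Proof.
move=> [M fM] x1; apply: ub_le_sup; last by exists x.
exists `|M| => _ [y y1 <-]; apply: le_trans (fM y) _.
by apply: le_trans (ler_norm _) _; rewrite normrM normr_id ler_piMr.
Qed.

Lemma opnorm_le f K : (forall x, `|x| <= 1 -> `|f x| <= K) -> opnorm f <= K.
Proof.
move=> fK; apply: ge_sup; last by move=> _ [x x1 <-]; exact: fK.
by exists `|f 0|, 0; rewrite /= ?normr0.
Qed.

Lemma le_opnorm_norm f x : bounded_operator f -> scalable f ->
  `|f x| <= opnorm f * `|x|.
Proof.
move=> fB fZ; have [->|x0] := eqVneq x 0.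
  by have := fZ 0 0; rewrite !scale0r => ->; rewrite !normr0 mulr0.
have nx : 0 < `|x| by rewrite normr_gt0.
rewrite -ler_pdivrMr// mulrC -[`|x|^-1]gtr0_norm ?invr_gt0// -normrZ -fZ.
by apply: le_opnorm => //; rewrite normrZ normfV normr_id mulVf// gt_eqF.
Qed.

Lemma bounded_sub_id f : bounded_operator f -> bounded_operator (fun x => x - f x).
Proof.
move=> [M fM]; exists (1 + M) => x; rewrite mulrDl mul1r.
by apply: le_trans (ler_normB _ _) _; rewrite lerD2l.
Qed.

Lemma opnorm_sub_id_le f : bounded_operator f ->
  opnorm (fun x => x - f x) <= 1 + opnorm f.
Proof.
move=> fB; apply: opnorm_le => x x1; apply: le_trans (ler_normB _ _) _.
by rewrite lerD// le_opnorm.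
Qed.

Lemma opnorm_ge0 f : bounded_operator f -> 0 <= opnorm f.
Proof.
by move=> fB; apply: le_trans (le_opnorm fB (x := 0) _); rewrite ?normr0.
Qed.

End Daugavet.

Lemma daugavet_almost_ideal (R : realType) (X : normedModType R) (Y : submodClosed X) :
  almost_ideal [set` Y] -> daugavet X -> daugavet (submod Y).
Proof.
move=> Yai dX T TB [v v0 Tv]; apply/eqP; rewrite eq_le opnorm_sub_id_le//= leNgt.
apply/negP => Klt; set K := opnorm _ in Klt.
have K0 : 0 <= K by apply: opnorm_ge0; exact: bounded_sub_id.
have /choice[g gT] : forall y, exists c, T y = c *: v.
  by move=> y; have [c _ <-] : range (fun c => c *: v) (T y); [rewrite -Tv; exists y|exists c].
have gI c d : c *: v = d *: v -> c = d.
  by move/eqP; rewrite -subr_eq0 -scalerBl scaler_eq0 (negPf v0) orbF subr_eq0 => /eqP.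
have gL : linear g.
  by move=> a y z; apply: gI; rewrite -gT linearP /= !gT scalerDl scalerA.
pose g' : {linear submod Y -> R} := HB.pack g (GRing.isLinear.Build _ _ _ _ _ gL).
have nv : 0 < `|v| by rewrite normr_gt0.
have [M TM] := TB; pose B := `|M| / `|v|.
have gB y : `|g' y| <= B * `|y|.
  rewrite /B mulrAC ler_pdivlMr// -normrZ -gT; apply: le_trans (TM y) _.
  by rewrite ler_wpM2r// ler_norm.
have gK y : `|y - g' y *: v| <= K * `|y|.
  rewrite /= -gT; apply: (le_opnorm_norm _ (bounded_sub_id TB)) => a z.
  by rewrite linearZ scalerBr.
have [|gX [gXg gXB gXK]] := functional_extension Yai _ K0 gB gK.
  by rewrite divr_ge0.
have SL : linear (fun x => gX x *: val v).
  by move=> a x y; rewrite linearP scalerDl scalerA.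
pose S : {linear X -> X} := HB.pack (fun x => gX x *: val v) (GRing.isLinear.Build _ _ _ _ _ SL).
have SB : bounded_operator S.
  exists (B * `|val v|) => x; rewrite /= normrZ mulrAC ler_wpM2r//.
have [y0 _ Ty0] : range T v by rewrite Tv; exists 1; rewrite ?scale1r.
have gy0 : g y0 = 1 by apply: gI; rewrite -gT scale1r.
have S1 : rank_one S.
  exists (val v); first by apply: contra_neq v0 => v0; exact: val_inj.
  apply/seteqP; split => x [z _ <-]; first by exists (gX z).
  exists (z *: val y0) => //=; rewrite linearZ gXg /= gy0.
  by rewrite -[z *: 1]/(z * 1) mulr1.
have := dX S SB S1.
have : opnorm (fun x => x - S x) <= K.
  by apply: opnorm_le => x x1; apply: le_trans (gXK x) _; rewrite ler_piMr.
have : opnorm T <= opnorm S.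
  apply: opnorm_le => y y1; have := le_opnorm SB (y1 : `|val y| <= 1).
  by rewrite /= gXg /= !normrZ gT normrZ.
move: Klt; lra.
Qed.

Lemma daugavet_countable_witness (R : realType) (X : normedModType R) : ~ daugavet X ->
  exists2 W : set X, countable W & forall Y : submodClosed X,
    W `<=` [set` Y] -> ~ daugavet (submod Y).
Proof.
move=> /existsNP[T] /not_implyP[TB] /not_implyP[[v v0 Tv] TD].
have Tlt : opnorm (fun x => x - T x) < 1 + opnorm T.
  by rewrite lt_neqAle opnorm_sub_id_le// andbT; apply/eqP.
have [u _ Tu] : range T v by rewrite Tv; exists 1; rewrite ?scale1r.
have /choice[x xP] : forall n : nat, exists x, `|x| <= 1 /\ opnorm T - n.+1%:R^-1 < `|T x|.
  move=> n; have n0 : 0 < n.+1%:R^-1 :> R by rewrite invr_gt0.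
  have [|_ [x x1 <-] Tx] := @sup_adherent _ [set `|T x| | x in [set x : X | `|x| <= 1]] _ n0.
    split; first by exists `|T 0|, 0; rewrite /= ?normr0.
    by exists (opnorm T) => _ [y y1 <-]; exact: le_opnorm.
  by exists x.
exists ([set u; v] `|` range x).
  by apply: countable_setU; [exact/finite_set_countable/finite_set2|exact: card_image_le].
move=> Y WY dY.
have Yv : v \in Y by apply: WY; left; right.
have Yu : u \in Y by apply: WY; left; left.
have Yx n : x n \in Y by apply: WY; right; exists n.
have YT y : T y \in Y.
  have [c _ <-] : range (fun c => c *: v) (T y) by rewrite -Tv; exists y.
  exact: rpredZ.
pose uY : submod Y := exist _ u Yu; pose vY : submod Y := exist _ v Yv.
pose f (y : submod Y) : submod Y := exist _ (T (val y)) (YT (val y)).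
have fL : linear f by move=> a y z; apply: val_inj; rewrite linearP /= linearP.
pose f' : {linear submod Y -> submod Y} := HB.pack f (GRing.isLinear.Build _ _ _ _ _ fL).
have fB : bounded_operator f' by have [M TM] := TB; exists M => y; exact: TM.
have f1 : rank_one f'.
  exists vY.
    by apply: contra_neq v0 => /(congr1 val).
  apply/seteqP; split => y [z _ <-].
    have [c _ cv] : range (fun c => c *: v) (T (val z)) by rewrite -Tv; exists (val z).
    by exists c => //; apply: val_inj.
  exists (z *: uY) => //; apply: val_inj.
  by rewrite /= linearZ /= Tu.
have := dY f' fB f1.
suff [h1 h2] : opnorm T <= opnorm f' /\ opnorm (fun y => y - f' y) <= opnorm (fun x => x - T x).
  by move=> e; move: h2; rewrite e; lra.
split; last first.
  apply: opnorm_le => y y1.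
  by apply: (le_opnorm (bounded_sub_id TB) (x := val y)).
apply: (@le_small_error _ _ _ 1) => // eps /andP[eps0 _]; rewrite mulr1.
pose n := Num.truncn eps^-1.
have [xn1 Txn] := xP n.
pose xY : submod Y := exist _ (x n) (Yx n).
have Tf : `|T (x n)| <= opnorm f' by exact: (@le_opnorm _ _ f' xY fB xn1).
have neps : n.+1%:R^-1 <= eps.
  by rewrite invf_ple ?posrE//; apply: ltW; exact: truncnS_gt.
by apply/ltW/(lt_le_trans _ (lerD Tf neps)); rewrite -ltrBlDr.
Qed.

Lemma gurarii_countable_witness (R : realType) (X : normedModType R) : ~ gurarii X ->
  exists2 W : set X, countable W & forall Y : submodClosed X,
    W `<=` [set` Y] -> ~ gurarii (submod Y).
Proof. by rewrite gurariiE => /extension_property_countable_witness. Qed.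

Lemma L1_predual_countable_witness (R : realType) (X : normedModType R) :
  ~ L1_predual X ->
  exists2 W : set X, countable W & forall Y : submodClosed X,
    W `<=` [set` Y] -> ~ L1_predual (submod Y).
Proof. by rewrite L1_predualE => /extension_property_countable_witness. Qed.

Lemma countable_determining_set (R : realType) (X : normedModType R)
    (P : normedModType R -> Prop) :
  (forall Y : submodClosed X, almost_ideal [set` Y] -> P X -> P (submod Y)) ->
  (~ P X -> exists2 W : set X, countable W & forall Y : submodClosed X,
    W `<=` [set` Y] -> ~ P (submod Y)) ->
  exists2 W : set X, countable W & forall Y : submodClosed X,
    W `<=` [set` Y] -> almost_ideal [set` Y] -> (P X <-> P (submod Y)).
Proof.
move=> Pup Pdown; have [PX|nPX] := pselect (P X).
  by exists set0 => // Y _ Yai; split => // _; exact: Pup.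
have [W cW WP] := Pdown nPX; exists W => // Y /WP nPY _; split => //.
Qed.

Lemma nonseparable_neq0 (R : realType) (X : normedModType R) :
  ~ separable X -> exists w : X, w != 0.
Proof.
move=> nX; apply: contrapT => no; apply: nX; exists [set 0]; first exact: countable1.
move=> U [x Ux] _; exists x; split => //=; apply/eqP; apply: contrapT => /negP x0.
by apply: no; exists x.
Qed.

Theorem theorem4 (R : realType) (X : completeNormedModType R)
    (hX : ~ separable X) :
  exists S : set (submodClosed X),
    exceedingly_rich [set [set` Y] | Y in S] /\
    forall Y : submodClosed X, S Y ->
      [/\ gurarii X <-> gurarii (submod Y),
          L1_predual X <-> L1_predual (submod Y)
        & daugavet X <-> daugavet (submod Y)].
Proof.
have [w w0] := nonseparable_neq0 hX.
have [W1 cW1 W1P] := countable_determining_set (@gurarii_almost_ideal R X)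
  (@gurarii_countable_witness R X).
have [W2 cW2 W2P] := countable_determining_set (@L1_predual_almost_ideal R X)
  (@L1_predual_countable_witness R X).
have [W3 cW3 W3P] := countable_determining_set (@daugavet_almost_ideal R X)
  (@daugavet_countable_witness R X).
pose W := W1 `|` W2 `|` W3 `|` [set w].
have cW : countable W by do 3!apply: countable_setU => //; exact: countable1.
exists (almost_ideals_over W); split.
  by apply: almost_ideals_exceedingly_rich w0 => //; right.
move=> Y [_ WY Yai]; split; [apply: W1P|apply: W2P|apply: W3P] => //;
  apply: subset_trans WY => x Wx.
- by left; left; left.
- by left; left; right.
- by left; right.
Qed.
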